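(* In the game of Picaria played from the empty board with player X moving first, player O cannot win; that is, X has a strategy which guarantees that O never obtains three O-stones on a line, whatever O does.
   Context: Picaria is played on the nine nodes of a $3\times 3$ grid; write $(r,c)$ for the node in row $r$ (rows $1,2,3$ from top to bottom) and column $c$ (columns $1,2,3$ from left to right). Two nodes are adjacent if they are distinct neighbours horizontally, vertically or diagonally (i.e. they differ by at most $1$ in each coordinate). A line is one of the eight triples of nodes forming a row, a column or one of the two main diagonals. Two players, X and O, each own three stones of their own type and alternate turns, X first. Phase 1 (placement): on each turn the mover places one of its stones on an empty node, until all six stones are on the board. Phase 2 (sliding): X starts, and on each turn the mover slides one of its own stones to an adjacent empty node. A player wins as soon as its three stones occupy a line. Play may go on forever (e.g. by repeating positions), in which case nobody wins. A player ''cannot win'' from a position if the opponent has a strategy from that position guaranteeing that the player never obtains three of its stones on a line. *)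

(* Defs.v *)
From HB Require Import structures.
From mathcomp Require Import all_boot.

Set Implicit Arguments.
Unset Strict Implicit.
Unset Printing Implicit Defensive.

Variant player := playerX | playerO.

Definition player_isX (p : player) : bool :=
  if p is playerX then true else false.
Definition player_of_bool (b : bool) : player :=
  if b then playerX else playerO.

Lemma player_isXK : cancel player_isX player_of_bool.
Proof. by case. Qed.

HB.instance Definition _ := Equality.copy player (can_type player_isXK).

Definition opponent (p : player) : player :=
  if p is playerX then playerO else playerX.

(* (row, column), numbered from 0. *)
Definition node : finType := ('I_3 * 'I_3)%type.

Definition adjacent (u v : node) : bool :=
  [&& u != v, u.1 <= v.1.+1, v.1 <= u.1.+1, u.2 <= v.2.+1 & v.2 <= u.2.+1].

Definition lines : {set {set node}} :=
  [set [set u : node | u.1 == i] | i : 'I_3] :|: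
  [set [set u : node | u.2 == j] | j : 'I_3] :|:
  [set [set u : node | u.1 == u.2]; [set u : node | u.1 + u.2 == 2]].

Definition board := {ffun node -> option player}.

Record position := Position { pos_board : board; pos_turn : player }.

Definition start : position := Position [ffun=> None] playerX.

Definition stones (s : position) (p : player) : {set node} :=
  [set u | pos_board s u == Some p].

Definition won (s : position) (p : player) : bool := stones s p \in lines.

Definition game_over (s : position) : bool := won s playerX || won s playerO.

(* The phase can be read off the board, since stones are never removed; and
   since the placement phase takes six turns, strict alternation makes X start
   the sliding phase too. *)
Definition placing (s : position) : bool :=
  #|[set u | pos_board s u != None]| < 6.

Variant move := Place of node | Slide of node & node.

Definition legal (s : position) (m : move) : bool :=
  ~~ game_over s &&
  match m with
  | Place v => placing s && (pos_board s v == None)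
  | Slide u v => [&& ~~ placing s, pos_board s u == Some (pos_turn s),
                     adjacent u v & pos_board s v == None]
  end.

Definition make_move (s : position) (m : move) : position :=
  let b := pos_board s in
  let p := pos_turn s in
  let b' : board :=
    match m with
    | Place v => [ffun w => if w == v then Some p else b w]
    | Slide u v =>
        [ffun w => if w == v then Some p else if w == u then None else b w]
    end in
  Position b' (opponent p).

(* A history lists the moves played so far, oldest first. *)
Definition position_after (s : position) (h : seq move) : position :=
  foldl make_move s h.

Definition strategy := seq move -> move.

(* The finite legal plays from s in which q moves according to sigma and the
   other player moves arbitrarily. An infinite play is represented by all of
   its finite prefixes. *)
Inductive play_following (s : position) (q : player) (sigma : strategy) :
    seq move -> Prop :=
  | play_nil : play_following s q sigma [::]
  | play_rcons h m :
      play_following s q sigma h ->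
      legal (position_after s h) m ->
      (pos_turn (position_after s h) = q -> m = sigma h) ->
      play_following s q sigma (rcons h m).

(* Without this condition, sigma could stop the play by proposing an illegal
   move. A player to move in an unfinished game from the empty board always has
   a legal move, so nothing has to be said about blocked players. *)
Definition legal_strategy (s : position) (q : player) (sigma : strategy) :
    Prop :=
  forall h : seq move, play_following s q sigma h ->
    ~~ game_over (position_after s h) ->
    pos_turn (position_after s h) = q ->
    legal (position_after s h) (sigma h).

Definition cannot_win (p : player) (s : position) : Prop :=
  exists sigma : strategy,
    legal_strategy s (opponent p) sigma /\
    forall h : seq move, play_following s (opponent p) sigma h ->
      ~~ won (position_after s h) p.

(* Main.v *)
Require Import Defs.
From mathcomp Require Import all_boot.

(** X opens in the centre and never leaves it except to win on the spot.  Call a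
    position with X to move and X in the centre tenable if X can win at once or
    make a move that keeps the centre and leaves O without a winning reply.  Looking
    a single round ahead is enough: a finite check over all boards shows that
    from a tenable position X can either win or move so that every reply of O
    leads to a tenable position again. *)

(** * Boards as lists of nine cells *)

Definition nodes : seq node :=
  let rows : seq 'I_3 :=
    [:: @Ordinal 3 0 isT; @Ordinal 3 1 isT; @Ordinal 3 2 isT] in
  [seq (i, j) | i <- rows, j <- rows].

Lemma mem_nodes u : u \in nodes.
Proof. by case: u => [[[|[|[|i]]] // ?] [[|[|[|j]]] // ?]]. Qed.

Lemma uniq_nodes : uniq nodes.
Proof. by vm_compute. Qed.

Lemma card_nodes (P : pred node) : #|[set u | P u]| = count P nodes.
Proof.
rewrite cardE -size_filter; apply/perm_size/uniq_perm.
- exact: enum_uniq.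
- exact: filter_uniq uniq_nodes.
by move=> u; rewrite mem_enum inE mem_filter mem_nodes andbT.
Qed.

Definition nindex (u : node) : nat := index u nodes.

Lemma nindex_inj : injective nindex.
Proof.
by move=> u v /(congr1 (nth u nodes)); rewrite !nth_index ?mem_nodes.
Qed.

Lemma nth_nodesK d i : i < 9 -> nindex (nth d nodes i) = i.
Proof. by move=> lti; rewrite /nindex index_uniq ?uniq_nodes. Qed.

Lemma nindex_lt v : nindex v < 9.
Proof. by rewrite (_ : 9 = size nodes) // index_mem mem_nodes. Qed.

Notation cells := (seq (option player)).

(** Plain lists in row-major order, so that the search over boards runs by [vm_compute]. *)
Definition code (b : board) : cells := map b nodes.

Lemma nth_code b u : nth None (code b) (nindex u) = b u.
Proof.
by rewrite (nth_map u) ?nth_index ?index_mem ?mem_nodes.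
Qed.

Lemma code_set (b : board) v c :
  code [ffun w => if w == v then c else b w]
  = set_nth None (code b) (nindex v) c.
Proof.
apply: (@eq_from_nth _ None) => [|i lti].
  by rewrite size_set_nth !size_map (maxn_idPr (nindex_lt v)).
rewrite size_map in lti; rewrite -(nth_nodesK v i lti).
by rewrite nth_code ffunE nth_set_nth /= (inj_eq nindex_inj) nth_code.
Qed.

(* Matching instead of [==], so that the kernel evaluates it cheaply. *)
Definition holds (p : player) (c : option player) : bool :=
  match p, c with
  | playerX, Some playerX | playerO, Some playerO => true
  | _, _ => false
  end.

Lemma holdsE p c : (c == Some p) = holds p c.
Proof. by case: p c => [] [[]|]. Qed.

(** * Lines as bit masks *)

Definition line_preds : seq (pred node) :=
  [:: (fun u : node => u.1 == @Ordinal 3 0 isT);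
      (fun u : node => u.1 == @Ordinal 3 1 isT);
      (fun u : node => u.1 == @Ordinal 3 2 isT);
      (fun u : node => u.2 == @Ordinal 3 0 isT);
      (fun u : node => u.2 == @Ordinal 3 1 isT);
      (fun u : node => u.2 == @Ordinal 3 2 isT);
      (fun u : node => u.1 == u.2);
      (fun u : node => u.1 + u.2 == 2)].

Definition masks : seq bitseq :=
  Eval vm_compute in [seq map l nodes | l : pred node <- line_preds].

Lemma ord3P (i : 'I_3) :
  [\/ i = @Ordinal 3 0 isT, i = @Ordinal 3 1 isT | i = @Ordinal 3 2 isT].
Proof.
by case: i => [[|[|[|i]]] // lti];
   [constructor 1 | constructor 2 | constructor 3]; apply: val_inj.
Qed.

(** Since [nodes] exhausts the type, a set is determined by its indicator along [nodes]; what
    remains is to match [lines] with the eight explicit predicates. *)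
Lemma linesE (A : {set node}) :
  (A \in lines) = ([seq u \in A | u <- nodes] \in masks).
Proof.
rewrite (_ : masks = [seq map l nodes | l : pred node <- line_preds]) //.
have -> : ([seq u \in A | u <- nodes] \in [seq map l nodes | l <- line_preds])
    = has (fun l : pred node => A == [set u | l u]) line_preds.
  (* Generalizing [nodes] keeps simplification from unfolding it into nine entries. *)
  move: nodes mem_nodes => ns mem_ns.
  elim: line_preds => //= l ls <-; rewrite inE; congr (_ || _).
  apply/eqP/eqP => [/eq_in_map eqA | ->].
    by apply/setP=> u; rewrite inE eqA ?mem_ns.
  by apply: eq_map => u; rewrite inE.
rewrite /lines !inE /has /line_preds orbF.
apply/idP/idP.
  case/orP=> [/orP[] /imsetP[i _ ->]|/orP[] ->]; rewrite ?orbT //.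
    by case: (ord3P i) => ->; rewrite eqxx ?orbT.
  by case: (ord3P i) => ->; rewrite eqxx ?orbT.
have row i : [set u : node | u.1 == i]
    \in [set [set u : node | u.1 == i] | i : 'I_3] by apply: imset_f.
have col i : [set u : node | u.2 == i]
    \in [set [set u : node | u.2 == i] | i : 'I_3] by apply: imset_f.
by do 7?[case/orP]; move=> H; rewrite ?H ?(eqP H) ?row ?col ?orbT.
Qed.

Definition wins (p : player) (s : cells) : bool := map (holds p) s \in masks.

Lemma wonE s p : won s p = wins p (code (pos_board s)).
Proof.
rewrite /won linesE /wins /code -map_comp.
by apply: (congr1 (mem masks)); apply: eq_map => u; rewrite inE holdsE.
Qed.

(** * Moves on lists *)

Definition empty (s : cells) (v : nat) : bool :=
  if nth None s v is None then true else false.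

Definition put (s : cells) (v : nat) (c : option player) : cells :=
  set_nth None s v c.

Definition adjacencies : seq (nat * nat) :=
  Eval vm_compute in
  [seq (nindex e.1, nindex e.2) |
    e <- [seq e <- [seq (u, v) | u <- nodes, v <- nodes] | adjacent e.1 e.2]].

Definition successors (p : player) (s : cells) : seq cells :=
  if count isSome s < 6 then
    [seq put s v (Some p) | v <- iota 0 9 & empty s v]
  else
    [seq put (put s e.1 None) e.2 (Some p) | e <- adjacencies
      & holds p (nth None s e.1) && empty s e.2].

Lemma adjacenciesP x :
  reflect (exists2 e : node * node, adjacent e.1 e.2
             & x = (nindex e.1, nindex e.2))
          (x \in adjacencies).
Proof.
rewrite (_ : adjacencies =
  [seq (nindex e.1, nindex e.2) | e : node * node <-
    [seq e <- [seq (u, v) | u <- nodes, v <- nodes] | adjacent e.1 e.2]]);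
  last by vm_compute.
apply: (iffP mapP) => [[e]|[[u v] adj ->]].
  by rewrite mem_filter => /andP[adj _] ->; exists e.
exists (u, v) => //; rewrite mem_filter adj.
exact: (allpairs_f pair (mem_nodes u) (mem_nodes v)).
Qed.

Lemma emptyE b v : empty (code b) (nindex v) = (b v == None).
Proof. by rewrite /empty nth_code; case: (b v). Qed.

Lemma placingE s : placing s = (count isSome (code (pos_board s)) < 6).
Proof.
rewrite /placing card_nodes count_map; congr (_ < _).
by apply: eq_count => u /=; case: (pos_board s u).
Qed.

Lemma code_place s v :
  code (pos_board (make_move s (Place v)))
  = put (code (pos_board s)) (nindex v) (Some (pos_turn s)).
Proof. exact: code_set. Qed.

Lemma code_slide s u v :
  code (pos_board (make_move s (Slide u v)))
  = put (put (code (pos_board s)) (nindex u) None)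
        (nindex v) (Some (pos_turn s)).
Proof.
(* The later update, at [v], is tested first, just as in [make_move]. *)
rewrite /put -!code_set /=; congr code; apply/ffunP => w.
by rewrite !ffunE.
Qed.

(** [successors] does not look for completed lines, whereas [legal] requires an unfinished game;
    hence the hypothesis, and hence [keeps] below tests both players for a win before listing
    replies. *)
Lemma successorsP s c : ~~ game_over s ->
  reflect (exists2 m, legal s m & c = code (pos_board (make_move s m)))
          (c \in successors (pos_turn s) (code (pos_board s))).
Proof.
move=> run; rewrite /successors -placingE.
case: ifP => placing_s; apply: (iffP mapP).
- case=> i; rewrite mem_filter mem_iota => /andP[emp /andP[_ lti]] ->.
  (* The default node is never returned, as [i < 9]. *)
  exists (Place (nth (ord0, ord0) nodes i)); last first.
    by rewrite code_place nth_nodesK.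
  by rewrite /legal run placing_s -emptyE nth_nodesK.
- case=> [[v|u v]]; rewrite /legal run placing_s // => emp ->.
  exists (nindex v); last by rewrite code_place.
  by rewrite mem_filter emptyE mem_iota nindex_lt !andbT.
- case=> e; rewrite mem_filter => /andP[emp /adjacenciesP[[u v] adj def_e]].
  move: emp; rewrite {}def_e => /andP[own emp] ->.
  exists (Slide u v); last by rewrite code_slide.
  by rewrite /legal run placing_s adj holdsE -nth_code -emptyE own emp.
case=> [[v|u v]]; rewrite /legal run placing_s //
  => /andP[_ /and4P[_ own adj emp]] ->.
exists (nindex u, nindex v); last by rewrite code_slide.
rewrite mem_filter /fst /snd nth_code -holdsE own emptyE emp andTb.
by apply/adjacenciesP; exists (u, v).
Qed.

(** * The finite check *)

(* Nested conditionals, here and below, because [vm_compute] evaluates both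
   arguments of [&&] and [||]. *)
Definition keeps (G : pred cells) (c : cells) : bool :=
  if wins playerO c then false
  else if wins playerX c then true else all G (successors playerO c).

Definition can_force (G : pred cells) (s : cells) : bool :=
  has (keeps G) (successors playerX s).

(* Index 4 is the centre in the row-major order of [nodes]. *)
Definition centred (s : cells) : bool :=
  holds playerX (nth None s 4) && ~~ wins playerO s.

(** True whenever X is to move in an actual game; it discards most lists before the costly
    search. *)
Definition balanced (s : cells) : bool :=
  [&& size s == 9, count (holds playerX) s == count (holds playerO) s
    & count (holds playerX) s <= 3].

Definition tenable (s : cells) : bool :=
  if balanced s && centred s then can_force centred s else false.

(** The predicate absorbs the cells chosen so far, so the list of all [3^n] boards is never
    built. *)
Fixpoint all_cells (n : nat) (P : pred cells) : bool :=
  if n is n'.+1 then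
    all (fun c => all_cells n' (fun s => P (c :: s)))
        [:: None; Some playerX; Some playerO]
  else P [::].

Lemma all_cellsP n P : all_cells n P -> forall s, size s = n -> P s.
Proof.
elim: n P => [|n IHn] P /=; first by move=> P0 [].
by case/and4P=> P0 PX PO _ [//|[[]|] s] [sz];
   [apply: IHn PX s sz | apply: IHn PO s sz | apply: IHn P0 s sz].
Qed.

(** Settled by evaluating all [3^9] lists. Boards where X already has a line are exempt, the game
    being over there. *)
Lemma all_tenable_round : all_cells 9 (fun s => if tenable s then
    if wins playerX s then true else can_force tenable s else true).
Proof. by vm_compute. Qed.

Lemma tenable_balanced_centred s : tenable s -> balanced s && centred s.
Proof. by rewrite /tenable; case: (balanced s && centred s). Qed.

Lemma tenable_round s :
  tenable s -> ~~ wins playerX s -> can_force tenable s.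
Proof.
move=> ten_s /negbTE nwin_s.
have /andP[/and3P[/eqP sz _ _] _] := tenable_balanced_centred s ten_s.
by have := all_cellsP _ _ all_tenable_round s sz; rewrite ten_s nwin_s.
Qed.

Lemma code_start : code (pos_board start) = nseq 9 None.
Proof.
by rewrite /code (eq_map (fun u => ffunE _ u)).
Qed.

(** The empty board is not [tenable], its centre being free, so the opening move is checked
    separately. *)
Lemma start_round : can_force tenable (code (pos_board start)).
Proof. by rewrite code_start; vm_compute. Qed.

(** * The strategy and its invariant *)

(** Presents moves through a finite type, over which [pick] can search. *)
Definition move_of (x : node + node * node) : move :=
  match x with inl v => Place v | inr (u, v) => Slide u v end.

Definition keeping (s : position) (m : move) : bool :=
  legal s m && keeps tenable (code (pos_board (make_move s m))).

Definition best (s : position) : move :=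
  if [pick x | keeping s (move_of x)] is Some x then move_of x
  else Place (ord0, ord0).

Lemma bestP s : ~~ game_over s -> pos_turn s = playerX ->
  can_force tenable (code (pos_board s)) -> keeping s (best s).
Proof.
move=> run turn_s /hasP[c in_c keep_c]; rewrite -turn_s in in_c.
have [m leg_m def_c] := successorsP s c run in_c.
rewrite /best; case: pickP => [x //|none].
have keep_m : keeping s m by rewrite /keeping leg_m -def_c.
have nkeep_m : keeping s m = false.
  by case: (m) => [v|u v]; [exact: (none (inl v)) | exact: (none (inr (u, v)))].
by rewrite nkeep_m in keep_m.
Qed.

(** With X to move the condition is [can_force tenable] rather than [tenable], so that it also
    covers the empty board. *)
Definition invariant (s : position) : Prop :=
  ~~ won s playerO /\
  (~~ game_over s ->
   if pos_turn s is playerX then can_force tenable (code (pos_board s))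
   else all tenable (successors playerO (code (pos_board s)))).

Lemma invariant_start : invariant start.
Proof.
split=> [|_]; last exact: start_round.
by rewrite wonE code_start; vm_compute.
Qed.

Lemma invariant_X s : pos_turn s = playerX -> keeping s (best s) ->
  invariant (make_move s (best s)).
Proof.
move=> turn_s /andP[_]; rewrite /invariant /game_over !wonE /keeps.
have -> : pos_turn (make_move s (best s)) = playerO by rewrite /= turn_s.
(* The branches of [keeps]: a line of O is excluded, a line of X ends the game, and otherwise all
   replies are tenable. *)
by case: (wins playerO _) => //; case: (wins playerX _).
Qed.

(** The move of O reaches a tenable board: [centred] rules out a line of O there, and
    [tenable_round] restores the forcing condition. *)
Lemma invariant_O s m : pos_turn s = playerO -> legal s m -> invariant s ->
  invariant (make_move s m).
Proof.
move=> turn_s leg_m [_].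
have run : ~~ game_over s by case/andP: leg_m.
rewrite turn_s => /(_ run)/allP ten_succ.
have ten_m : tenable (code (pos_board (make_move s m))).
  by apply: ten_succ; rewrite -turn_s; apply/(successorsP s _ run); exists m.
rewrite /invariant /game_over !wonE.
have -> : pos_turn (make_move s m) = playerX by rewrite /= turn_s.
split; last by case/norP=> nwin _; exact: tenable_round.
by case/andP: (tenable_balanced_centred _ ten_m) => _ /andP[].
Qed.

Theorem theorem2p1 : cannot_win playerO start.
Proof.
(* The strategy is positional: the history matters only through the position reached. *)
exists (fun h => best (position_after start h)) => /=.
have inv h : play_following start playerX
    (fun h => best (position_after start h)) h ->
    invariant (position_after start h).
  elim=> [|{}h m _ inv_h leg_m def_m]; first exact: invariant_start.
  rewrite /position_after foldl_rcons -/(position_after _ _).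
  case turn_h: (pos_turn (position_after start h)); last exact: invariant_O.
  rewrite (def_m turn_h); apply: invariant_X => //.
  have run : ~~ game_over (position_after start h) by case/andP: leg_m.
  by apply: bestP => //; case: inv_h => _ /(_ run); rewrite turn_h.
(* Safety is the first half of the invariant; legality of the strategy follows from the second half
   through [bestP]. *)
split=> [h /inv[_ force_h] run turn_h | h /inv[] //].
have := force_h run; rewrite turn_h => can_h.
by case/andP: (bestP _ run turn_h can_h).
Qed.
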